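(* Let $n\ge1$ be an integer. For all bounded functions $f,g:[0,1]\to\mathbb{R}$ and all $x\in[0,1]$, $$\left|B_n(f\cdot g)(x)-B_nf(x)\cdot B_ng(x)\right|\le\frac12\left(1-\frac1{4^n}\binom{2n}{n}\right)\cdot osc_{B_n}(f)\cdot osc_{B_n}(g).$$
   Context: $B_n$ is the classical Bernstein operator, $B_nf(x):=\sum_{k=0}^n f\left(\frac kn\right)\binom nk x^k(1-x)^{n-k}$, $x\in[0,1]$. The oscillation is $osc_{B_n}(f):=\max\{|f(k/n)-f(l/n)|:0\le k<l\le n\}$, and similarly for $g$. *)

(* Defs.v *)
From HB Require Import structures.
From mathcomp Require Import all_boot all_order all_algebra.
From mathcomp Require Import all_classical all_reals all_analysis.
Set Implicit Arguments.
Unset Strict Implicit.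
Unset Printing Implicit Defensive.
Import Order.TTheory GRing.Theory Num.Theory.
Import numFieldNormedType.Exports.
Local Open Scope classical_set_scope.
Local Open Scope ring_scope.

(* A function on [0, 1] is represented by a total f : R -> R, of which only
   the values on [0, 1] matter: the nodes k / n all lie in [0, 1]. *)
Definition bernstein (R : realType) (n : nat) (f : R -> R) (x : R) : R :=
  \sum_(k < n.+1) f (k%:R / n%:R) * 'C(n, k)%:R * x ^+ k * (1 - x) ^+ (n - k).

(* The seed 0 of the iterated maximum does not affect its value when 1 <= n:
   the index range is then nonempty and every term is nonnegative. *)
Definition osc_bernstein (R : realType) (n : nat) (f : R -> R) : R :=
  \big[Num.max/0]_(k < n.+1) \big[Num.max/0]_(l < n.+1 | (k < l)%N)
    `|f (k%:R / n%:R) - f (l%:R / n%:R)|.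

(* Main.v *)
(** With the weights [b_k = 'C(n, k) x^k (1 - x)^(n - k)], which sum to 1, the
    covariance on the left is half the sum of
    [b_k b_l (f_k - f_l) (g_k - g_l)] over [k != l], hence at most
    [1/2 (1 - sum_k b_k^2)] times the product of the oscillations.  It remains
    to see that [sum_k b_k^2 >= 'C(2n, n) / 4^n].  Put [y := 1 - x].  The sum is
    the coefficient of [X^n] in
    [((xX + y) (yX + x))^n = (xy (X + 1)^2 + (x - y)^2 X)^n],
    that is [sum_j 'C(n, j) (1 - w)^(n - j) w^j 'C(2j, j) / 4^j] where
    [w := 4xy] lies in [[0, 1]]: an average of the numbers ['C(2j, j) / 4^j],
    [j <= n], the smallest of which is the one for [j = n]. *)
Require Import Defs.
From HB Require Import structures.
From mathcomp Require Import all_boot all_order all_algebra.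
From mathcomp Require Import all_classical all_reals all_analysis.
From mathcomp Require Import ring zify.
Import Order.TTheory GRing.Theory Num.Theory.
Import numFieldNormedType.Exports.
Local Open Scope classical_set_scope.
Local Open Scope ring_scope.

Lemma coef_exp_linear (R : comNzRingType) (a b : R) (n k : nat) :
  ((a *: 'X + b%:P) ^+ n)`_k = 'C(n, k)%:R * a ^+ k * b ^+ (n - k).
Proof.
rewrite addrC exprDn coef_sum.
have coefi (i : 'I_n.+1) :
    (b%:P ^+ (n - i) * (a *: 'X) ^+ i *+ 'C(n, i))`_k =
    if i == k :> nat then 'C(n, k)%:R * a ^+ k * b ^+ (n - k) else 0.
  rewrite coefMn -polyC_exp mul_polyC coefZ exprZn coefZ coefXn eq_sym.
  case: eqP => [->|_]; last by rewrite !mulr0 mul0rn.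
  by rewrite mulr1 -mulr_natl; ring.
rewrite (eq_bigr _ (fun i _ => coefi i)) -big_mkcond /=.
case: (ltnP k n.+1) => [lt_kn|lt_nk].
  by rewrite (big_pred1 (Ordinal lt_kn)).
(* Beyond the degree no index equals [k], and ['C(n, k)] vanishes as well. *)
rewrite big1; first by rewrite bin_small ?mul0r.
by move=> i /eqP eq_ik; move: (ltn_ord i); rewrite eq_ik ltnNge lt_nk.
Qed.

Lemma sum_sqr_binomial (R : comNzRingType) (p q : R) (n : nat) :
  \sum_(k < n.+1) ('C(n, k)%:R * p ^+ k * q ^+ (n - k)) ^+ 2 =
  \sum_(j < n.+1) 'C(n, j)%:R * ((p - q) ^+ 2) ^+ (n - j) * (p * q) ^+ j *
                  'C(j.*2, j)%:R.
Proof.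
pose P : {poly R} := (p *: 'X + q%:P) * (q *: 'X + p%:P).
transitivity (P ^+ n)`_n.
  rewrite exprMn coefM; apply: eq_bigr => k _.
  have le_kn : (k <= n)%N by rewrite -ltnS.
  (* The second factor has [p] and [q] swapped, so by symmetry of the binomials its coefficient at
     [n - k] equals that of the first at [k]: the convolution is a sum of squares. *)
  rewrite !coef_exp_linear subKn // bin_sub //.
  by rewrite expr2; ring.
have -> : P = ((p - q) ^+ 2) *: 'X + (p * q) *: (1 *: 'X + 1%:P) ^+ 2.
  by rewrite /P -!mul_polyC !polyC_exp !polyCM polyCB; ring.
rewrite exprDn coef_sum; apply: eq_bigr => j _.
have le_jn : (j <= n)%N by rewrite -ltnS.
(* The factor ['X^(n - j)] shifts the index, leaving the coefficient of ['X^j] in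
   [('X + 1)^(2j)]. *)
rewrite coefMn !exprZn -scalerAl coefZ -scalerAr coefZ coefXnM.
rewrite ltnNge leq_subr /= subKn // -[_ ^+ 2 ^+ j]exprM mul2n coef_exp_linear.
by rewrite !expr1n !mulr1 -mulr_natl; ring.
Qed.

(** One step suffices: Pascal's rule and symmetry give ['C(2k+2, k+1) = 2 ('C(2k, k) + 'C(2k,
    k+1))], at most [4 'C(2k, k)] since the central coefficient dominates its neighbour. *)
Lemma central_bin_ratio_le (R : realFieldType) (m n : nat) : (m <= n)%N ->
  ('C(n.*2, n))%:R / 4 ^+ n <= ('C(m.*2, m))%:R / 4 ^+ m :> R.
Proof.
move=> /subnKC <-; elim: (n - m)%N => [|d IHd]; first by rewrite addn0.
apply: le_trans IHd; rewrite addnS; move: (m + d)%N => k.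
rewrite exprS invfM mulrA ler_pM2r ?invr_gt0 ?exprn_gt0 //.
rewrite ler_pdivrMr // -natrM ler_nat.
have le_mid : ('C(k.*2, k.+1) <= 'C(k.*2, k))%N.
  rewrite -(leq_pmul2l (ltn0Sn k)) mul_bin_left -addnn addnK.
  by rewrite leq_mul2r leqnSn orbT.
have sym : 'C(k.*2.+1, k) = 'C(k.*2.+1, k.+1).
  by rewrite -[RHS]bin_sub ?subSS -?addnn ?addnK // ltnS leq_addr.
by rewrite doubleS binS sym binS; lia.
Qed.

Lemma sum_sqr_binomial_ge (R : realFieldType) (x : R) (n : nat) :
  0 <= x <= 1 ->
  ('C(n.*2, n))%:R / 4 ^+ n <=
  \sum_(k < n.+1) ('C(n, k)%:R * x ^+ k * (1 - x) ^+ (n - k)) ^+ 2.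
Proof.
move=> /andP[x_ge0 x_le1]; rewrite sum_sqr_binomial.
pose w : R := 4 * (x * (1 - x)).
have w_ge0 : 0 <= w by rewrite !mulr_ge0 ?subr_ge0.
(* This identity yields [w <= 1] and turns the coefficients into binomial weights of sum 1. *)
have dw : (x - (1 - x)) ^+ 2 = 1 - w by rewrite /w; ring.
have w_le1 : 0 <= 1 - w by rewrite -dw sqr_ge0.
have sum1 : \sum_(j < n.+1) 'C(n, j)%:R * (1 - w) ^+ (n - j) * w ^+ j = 1.
  rewrite -[RHS](expr1n _ n) -[X in _ = X ^+ n](subrK w) exprDn.
  by apply: eq_bigr => j _; rewrite -mulr_natl; ring.
rewrite -[leLHS]mul1r -[X in X * _]sum1 mulr_suml; apply: ler_sum => j _.
have -> : x * (1 - x) = w / 4 by rewrite /w; field.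
rewrite dw expr_div_n [leRHS](_ : _ = 'C(n, j)%:R * (1 - w) ^+ (n - j) * w ^+ j *
  ('C(j.*2, j)%:R / 4 ^+ j)); last by ring.
by rewrite ler_wpM2l ?mulr_ge0 ?exprn_ge0 ?central_bin_ratio_le // -ltnS.
Qed.

Lemma covariance_le (R : realFieldType) (I : finType) (b u v : I -> R)
    (M N : R) :
  (forall i, 0 <= b i) -> \sum_i b i = 1 ->
  (forall i j, `|u i - u j| <= M) -> (forall i j, `|v i - v j| <= N) ->
  `|\sum_i b i * (u i * v i) - (\sum_i b i * u i) * (\sum_i b i * v i)| <=
  2^-1 * (1 - \sum_i b i ^+ 2) * M * N.
Proof.
move=> b_ge0 sum_b uM vN.
set c := _ - _.
have dc : c = 2^-1 * \sum_i \sum_j b i * b j * ((u i - u j) * (v i - v j)).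
  have -> : \sum_i \sum_j b i * b j * ((u i - u j) * (v i - v j)) =
     (\sum_i b i * (u i * v i)) * (\sum_j b j)
     - (\sum_i b i * u i) * (\sum_j b j * v j)
     - (\sum_i b i * v i) * (\sum_j b j * u j)
     + (\sum_i b i) * (\sum_j b j * (u j * v j)).
    rewrite !big_distrlr /= -!sumrB -big_split /=; apply: eq_bigr => i _.
    by rewrite -!sumrB -big_split /=; apply: eq_bigr => j _; ring.
  by rewrite sum_b /c; field.
(* Write 1 as the square of the total weight and remove the diagonal. *)
have dS : 1 - \sum_i b i ^+ 2 = \sum_i \sum_(j | j != i) b i * b j.
  rewrite -[1](mulr1 1) -{1 2}sum_b big_distrlr /= -sumrB.
  apply: eq_bigr => i _.
  by rewrite (bigD1 i) //= expr2 addrAC subrr add0r.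
rewrite dc normrM ger0_norm ?invr_ge0 // -!mulrA ler_wpM2l ?invr_ge0 //.
rewrite dS mulr_suml; apply: le_trans (ler_norm_sum _ _ _) (ler_sum _ _) => i _.
rewrite mulr_suml (bigD1 i) //= !subrr !mulr0 add0r.
apply: le_trans (ler_norm_sum _ _ _) (ler_sum _ _) => j _.
by rewrite normrM ger0_norm ?mulr_ge0 // ler_wpM2l ?mulr_ge0 // normrM ler_pM.
Qed.

Lemma le_osc_bernstein (R : realType) (n : nat) (f : R -> R) (k l : 'I_n.+1) :
  `|f (k%:R / n%:R) - f (l%:R / n%:R)| <= osc_bernstein n f.
Proof.
wlog lt_kl : k l / (k < l)%N.
  move=> ltP; case: (ltngtP k l) => [/ltP //|/ltP|/val_inj ->].
    by rewrite distrC.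
  (* The maximum omits the diagonal pairs; their value 0 is bounded by its seed. *)
  by rewrite subrr normr0 /osc_bernstein; apply: bigmax_ge_id.
apply: le_trans (le_bigmax _ _ k).
exact: (le_bigmax_cond _ (fun l : 'I_n.+1 => `|f (k%:R / n%:R) - f (l%:R / n%:R)|)).
Qed.

Theorem theorem3p6 (R : realType) (n : nat) (hn : (1 <= n)%N) (f g : R -> R)
    (hf : [bounded f x | x in `[0, 1] : set R])
    (hg : [bounded g x | x in `[0, 1] : set R])
    (x : R) (hx : x \in `[0, 1]) :
  `|bernstein n (f \* g) x - bernstein n f x * bernstein n g x| <=
    2^-1 * (1 - ('C(n.*2, n))%:R / 4 ^+ n) *
    osc_bernstein n f * osc_bernstein n g.
Proof.
have x01 : 0 <= x <= 1 by move: hx; rewrite in_itv.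
have [x_ge0 x_le1] := andP x01.
pose b (k : 'I_n.+1) : R := 'C(n, k)%:R * x ^+ k * (1 - x) ^+ (n - k).
have b_ge0 k : 0 <= b k by rewrite !mulr_ge0 ?exprn_ge0 ?subr_ge0.
have sum_b : \sum_k b k = 1.
  rewrite -[RHS](expr1n _ n) -[X in _ = X ^+ n](subrK x) exprDn.
  by apply: eq_bigr => k _; rewrite /b -mulr_natl; ring.
have bernsteinE h : bernstein n h x = \sum_k b k * h ((k : 'I_n.+1)%:R / n%:R).
  by apply: eq_bigr => k _; rewrite /b; ring.
rewrite !bernsteinE.
have := covariance_le _ _ b _ _ _ _ b_ge0 sum_b
  (le_osc_bernstein R n f) (le_osc_bernstein R n g).
move=> /le_trans; apply.
have osc_ge0 (h : R -> R) : 0 <= osc_bernstein n h.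
  exact: le_trans (normr_ge0 _) (le_osc_bernstein R n h ord0 ord0).
rewrite !ler_wpM2r // ler_wpM2l ?invr_ge0 // lerB //.
exact: sum_sqr_binomial_ge.
Qed.
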